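(* Let $\delta_1>0$ be an admissible one-dimensional sum-product exponent, i.e. a constant such that every finite, non-empty set $B\subseteq\mathbb{R}$ satisfies $|B+B|+|B\cdot B|\gtrsim |B|^{1+\delta_1}$. Let $d\in\mathbb{N}$. Then for every finite, non-empty set $A$ of $d\times d$ diagonal matrices with real entries, \[ |A+A|+|A\cdot A| \gtrsim_d |A|^{1+\delta_1/d}, \] where $A+A$ and $A\cdot A$ are formed with ordinary matrix addition and multiplication.
   Context: For finite sets $A,B$ of matrices, $A+B=\{a+b: a\in A, b\in B\}$ and $A\cdot B=\{ab: a\in A,b\in B\}$. Notation: $X\gtrsim Y$ means $|X|\ge C|Y|(\log|A|)^{D}$ for some constants $C>0$ and $D$ (with $A$ the set under consideration); $X\gtrsim_z Y$ means the same with $C$ and $D$ allowed to depend on the parameter $z$. The paper takes $\delta_1$ to be the best known such exponent; by a result of Shakan, $\delta_1=1/3+5/5277$ is admissible. *)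

(* Defs.v *)
From HB Require Import structures.
From mathcomp Require Import all_boot all_order all_algebra.
From mathcomp Require Import finmap.
From mathcomp Require Import reals exp.
Set Implicit Arguments. Unset Strict Implicit. Unset Printing Implicit Defensive.
Import Order.TTheory GRing.Theory Num.Theory.
Local Open Scope ring_scope.
Local Open Scope fset_scope.

Definition rsumset (R : realType) (B : {fset R}) : {fset R} :=
  [fset (a + b)%R | a in B, b in B].
Definition rprodset (R : realType) (B : {fset R}) : {fset R} :=
  [fset (a * b)%R | a in B, b in B].

Definition msumset (R : realType) (d : nat) (A : {fset 'M[R]_d}) : {fset 'M[R]_d} :=
  [fset (a + b)%R | a in A, b in A].
Definition mprodset (R : realType) (d : nat) (A : {fset 'M[R]_d}) : {fset 'M[R]_d} :=
  [fset (a *m b)%R | a in A, b in A].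

(* X >~ Y for a quantity attached to sets S of size n = #|S|:
   there are constants C > 0 and D (real) such that
   X S >= C * Y S * (log n)^D for every set S with n >= 2
   (for n >= 2 the logarithm is positive, so (log n)^D is meaningful). *)
Definition gtrsim (T : choiceType) (R : realType)
    (X Y : {fset T} -> R) : Prop :=
  exists C : R, 0 < C /\ exists D : R,
    forall S : {fset T}, (2 <= #|` S|)%N ->
      C * Y S * powR (ln (#|` S|%:R)) D <= X S.

Definition sum_product_exponent (R : realType) (delta : R) : Prop :=
  gtrsim (fun B : {fset R} => (#|` rsumset B| + #|` rprodset B|)%:R)
         (fun B : {fset R} => powR (#|` B|%:R) (1 + delta)).

Definition diag_set (R : realType) (d : nat) (A : {fset 'M[R]_d}) : bool :=
  [forall a : A, is_diag_mx (val a)].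

(* Main.v *)
(* Split A according to the signs of the entries; on one large class only the
   set S of coordinates that never vanish matters, each having constant sign.
   Induct on k = |S|.  Fix a coordinate in S and pigeonhole dyadically to find
   a set X of values over each of which A has at least m points, with
   |A| <= 2 l |X| m, where l is logarithmic.  Then |A+A| + |AA| dominates both
   m (|X+X| + |XX|) and the sum over x in X of the same quantity for the fibre
   A_x, since x |-> 2x and, by the constant sign, x |-> x^2 are injective on X.
   If |X| >= |A|^(1/k) up to logarithms, the hypothesis on real sets and the
   first bound suffice; otherwise m >= |A|^((k-1)/k), and the induction
   hypothesis in the fibres and the second bound suffice. *)
Require Import Defs.
From HB Require Import structures.
From mathcomp Require Import all_boot all_order all_algebra.
From mathcomp Require Import finmap.
From mathcomp Require Import reals exp.
Import Order.TTheory GRing.Theory Num.Theory.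
Local Open Scope fset_scope.
Local Open Scope ring_scope.

(** * Finite sets under a binary operation, and fibres of a map *)

Definition opset {T : choiceType} (op : T -> T -> T) (A : {fset T}) : {fset T} :=
  [fset op a b | a in A, b in A].

Definition fibre {T K : choiceType} (f : T -> K) (A : {fset T}) (x : K) :
  {fset T} := [fset a in A | f a == x].

(* The number of dyadic scales [2^j, 2^(j+1)) meeting {1, .., n}. *)
Definition dlog (n : nat) : nat := (trunc_log 2 n).+1.

Lemma opsetP (T : choiceType) (op : T -> T -> T) (A : {fset T}) (t : T) :
  reflect (exists a b, [/\ a \in A, b \in A & t = op a b]) (t \in opset op A).
Proof.
apply: (iffP idP) => [/imfset2P[a aA [b bA ->]]|[a [b [aA bA ->]]]].
  by exists a, b.
by apply/imfset2P; exists a => //; exists b.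
Qed.

Lemma opset_sub (T : choiceType) (op : T -> T -> T) (A B : {fset T}) :
  A `<=` B -> opset op A `<=` opset op B.
Proof.
move=> /fsubsetP AB; apply/fsubsetP => _ /opsetP[a [b [aA bA ->]]].
by apply/opsetP; exists a, b; rewrite !AB.
Qed.

Lemma card_opset_gt0 (T : choiceType) (op : T -> T -> T) (A : {fset T}) :
  (0 < #|` A|)%N -> (0 < #|` opset op A|)%N.
Proof.
rewrite !cardfs_gt0 => /fset0Pn[a aA]; apply/fset0Pn; exists (op a a).
by apply/opsetP; exists a, a.
Qed.

Lemma fibreP (T K : choiceType) (f : T -> K) (A : {fset T}) (x : K) (a : T) :
  reflect (a \in A /\ f a = x) (a \in fibre f A x).
Proof. by rewrite !inE; apply: (iffP andP) => -[aA /eqP]. Qed.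

Lemma fibre_sub (T K : choiceType) (f : T -> K) (A : {fset T}) (x : K) :
  fibre f A x `<=` A.
Proof. by apply/fsubsetP => a /fibreP[]. Qed.

Lemma card_le1_inj (T : choiceType) (A : {fset T}) :
  {in A &, forall a b, a = b} -> (#|` A| <= 1)%N.
Proof.
have [->|/fset0Pn[a aA] eqA] := eqVneq A fset0; first by rewrite cardfs0.
rewrite -(cardfs1 a) fsubset_leq_card //; apply/fsubsetP => b bA.
by rewrite inE (eqA b a).
Qed.

Lemma sum_card_disjoint (I T : choiceType) (X : {fset I}) (F : I -> {fset T})
    (B : {fset T}) :
    {in X, forall x, F x `<=` B} ->
    {in X &, forall x y, forall t, t \in F x -> t \in F y -> x = y} ->
  (\sum_(x <- X) #|` F x| <= #|` B|)%N.
Proof.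
move=> FB Finj.
have cardF x : x \in X -> #|` F x| = (\sum_(t <- B) (t \in F x))%N.
  move=> xX; have {1}-> : F x = [fset t in B | t \in F x].
    apply/fsetP => t; rewrite !inE; case tF: (t \in F x); rewrite ?andbF //.
    by rewrite (fsubsetP (FB x xX)).
  rewrite card_fset_sum1 -big_fset_condE big_mkcond /=.
  by apply: eq_bigr => t _; case: (t \in F x).
rewrite (eq_big_seq _ cardF) exchange_big card_fset_sum1 /=.
apply: leq_sum => t _.
have [/hasP[x xX tFx]|/hasPn noF] := boolP (has (fun x => t \in F x) X).
  rewrite (big_fsetD1 x) //= tFx big_seq big1 // => y.
  rewrite !inE => /andP[yx yX]; case tFy: (t \in F y) => //.
  by rewrite (Finj y x yX xX t tFy tFx) eqxx in yx.
by rewrite big_seq big1 // => x /noF/negbTE->.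
Qed.

Lemma card_sum_fibre (T K : choiceType) (f : T -> K) (A : {fset T}) :
  #|` A| = (\sum_(x <- [fset f a | a in A]) #|` fibre f A x|)%N.
Proof.
apply/eqP; rewrite eqn_leq; apply/andP; split; last first.
  apply: sum_card_disjoint => [x _|x y _ _ t /fibreP[_ <-] /fibreP[_ <-]] //.
  exact: fibre_sub.
set X := imfset _ _ _.
have cardF x : #|` fibre f A x| = (\sum_(a <- A) (f a == x))%N.
  rewrite /fibre card_fset_sum1 -big_fset_condE big_mkcond /=.
  by apply: eq_bigr => a _; case: eqP.
under eq_bigr => x _ do rewrite cardF.
rewrite exchange_big /= card_fset_sum1 big_seq [leqRHS]big_seq.
apply: leq_sum => a aA; have faX : f a \in X by apply/imfsetP; exists a.
by rewrite (big_fsetD1 (f a)) //= eqxx.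
Qed.

(** * Pigeonholing over finitely many classes and over dyadic scales *)

Lemma exists_large_term (I : finType) (F : I -> nat) :
  (0 < #|I|)%N -> exists i, (\sum_j F j <= #|I| * F i)%N.
Proof.
move=> I0; have [i Fi] := bigop.eq_bigmax F I0; exists i.
rewrite -Fi -sum_nat_const; apply: leq_sum => j _; exact: leq_bigmax.
Qed.

Lemma exists_large_fibre (T : choiceType) (I : finType) (f : T -> I)
    (A : {fset T}) :
  (0 < #|I|)%N -> exists i, (#|` A| <= #|I| * #|` fibre f A i|)%N.
Proof.
move=> I0; have [i Fi] := exists_large_term I (fun i => #|` fibre f A i|) I0.
exists i; apply: leq_trans Fi; rewrite (card_sum_fibre _ _ f).
rewrite big_uniq ?fset_uniq //= [leqRHS](bigID (mem [fset f a | a in A])) /=.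
exact: leq_addr.
Qed.

Lemma dyadic_fibres (T K : choiceType) (f : T -> K) (A : {fset T}) :
  exists (X : {fset K}) (m : nat), [/\ (0 < m)%N, (#|` X| <= #|` A|)%N,
    {in X, forall x, (m <= #|` fibre f A x|)%N} &
    (#|` A| <= (2 * dlog #|` A|) * (#|` X| * m))%N].
Proof.
pose Y := [fset f a | a in A]; pose w x := #|` fibre f A x|.
have w0 x : x \in Y -> (0 < w x)%N.
  move=> /imfsetP[a /= aA ->]; rewrite cardfs_gt0; apply/fset0Pn; exists a.
  exact/fibreP.
have wA x : (w x <= #|` A|)%N by rewrite fsubset_leq_card ?fibre_sub.
have log_lt x : (trunc_log 2 (w x) < dlog #|` A|)%N.
  by rewrite ltnS leq_trunc_log.
pose g x : 'I_(dlog #|` A|) := Ordinal (log_lt x).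
have [|j] := exists_large_term _
  (fun j => (\sum_(x <- Y | g x == j) w x)%N); first by rewrite card_ord.
have -> : (\sum_j \sum_(x <- Y | g x == j) w x = #|` A|)%N.
  by apply/esym; rewrite [LHS](card_sum_fibre _ _ f A) (partition_big g predT).
rewrite card_ord => Aj.
exists [fset x in Y | g x == j], (2 ^ j)%N; split.
- by rewrite expn_gt0.
- apply: leq_trans (_ : #|` Y| <= _)%N; last exact: leq_imfset_card.
  by apply/fsubset_leq_card/fsubsetP => x; rewrite !inE => /andP[].
- move=> x; rewrite !inE => /andP[xY /eqP <-] /=.
  by apply: trunc_logP => //; apply: w0.
apply: leq_trans Aj _; rewrite [(2 * _)%N]mulnC -mulnA leq_mul2l; apply/orP; right.
rewrite mulnCA -expnS [X in (_ <= X * _)%N]card_fset_sum1.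
rewrite -big_fset_condE /= big_distrl /=.
rewrite big_seq_cond [leqRHS]big_seq_cond.
apply: leq_sum => x /andP[_ /eqP <-].
by rewrite mul1n /= ltnW // trunc_log_ltn.
Qed.

(** * Two lower bounds for an operation set through fibres *)

Lemma card_opset_fibres (T K : choiceType) (op : T -> T -> T)
    (opK : K -> K -> K) (f : T -> K) (A : {fset T}) (X : {fset K}) (m : nat) :
    {in A &, {morph f : a b / op a b >-> opK a b}} ->
    {in A & &, forall b a a', op a b = op a' b -> a = a'} ->
    (0 < m)%N -> {in X, forall x, (m <= #|` fibre f A x|)%N} ->
  (#|` opset opK X| * m <= #|` opset op A|)%N.
Proof.
move=> fM opI m0 Xm.
apply: leq_trans (_ : \sum_(s <- opset opK X) #|` fibre f (opset op A) s| <= _)%N.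
  rewrite card_fset_sum1 big_distrl /= big_seq [leqRHS]big_seq.
  apply: leq_sum => _ /opsetP[x [y [xX yX ->]]]; rewrite mul1n.
  (* One [b] over [y] suffices: operating by [b] maps the fibre over [x] injectively into the part
     of [opset op A] lying over [opK x y]. *)
  have /fset0Pn[b /fibreP[bA fb]] : fibre f A y != fset0.
    by rewrite -cardfs_gt0 (leq_trans m0) ?Xm.
  apply: leq_trans (Xm x xX) _.
  have <- : #|` [fset op a b | a in fibre f A x]| = #|` fibre f A x|.
    rewrite card_in_imfset //= => a a' /fibreP[aA _] /fibreP[a'A _].
    exact: opI.
  apply/fsubset_leq_card/fsubsetP => _ /imfsetP[a /fibreP[aA fa] ->].
  apply/fibreP; split; last by rewrite fM // fa fb.
  by apply/opsetP; exists a, b.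
apply: sum_card_disjoint => [s _|s s' _ _ t /fibreP[_ <-] /fibreP[_ <-]] //.
exact: fibre_sub.
Qed.

(** Everything produced inside the fibre over [x] lies over [opK x x], so injectivity of this
    diagonal map on the values of [f] makes the summands disjoint. *)
Lemma sum_card_opset_fibre (T K : choiceType) (op : T -> T -> T)
    (opK : K -> K -> K) (f : T -> K) (A : {fset T}) (X : {fset K}) :
    {in A &, {morph f : a b / op a b >-> opK a b}} ->
    {in A &, forall a b, opK (f a) (f a) = opK (f b) (f b) -> f a = f b} ->
  (\sum_(x <- X) #|` opset op (fibre f A x)| <= #|` opset op A|)%N.
Proof.
move=> fM sqI; apply: sum_card_disjoint => [x _|x y _ _ t].
  exact/opset_sub/fibre_sub.
move=> /opsetP[a [b [/fibreP[aA fa] /fibreP[bA fb] ->]]].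
move=> /opsetP[a' [b' [/fibreP[a'A fa'] /fibreP[b'A fb']]]] /(congr1 f).
by rewrite !fM // fb fb' -fa -fa' => /sqI->.
Qed.

(** * Comparing [ln], [dlog] and real powers *)

Lemma leq_dlog (m n : nat) : (m <= n)%N -> (dlog m <= dlog n)%N.
Proof. by move=> mn; rewrite ltnS leq_trunc_log. Qed.

Lemma ln2_gt0 (R : realType) : 0 < ln (2 : R).
Proof. by rewrite ln_gt0 // ltr1n. Qed.

Lemma ln_nat_ge_ln2 (R : realType) (n : nat) :
  (2 <= n)%N -> ln (2 : R) <= ln (n%:R : R).
Proof. by move=> n2; rewrite ler_ln ?posrE ?ltr0n ?ler_nat // (leq_trans _ n2). Qed.

Lemma ln_le_dlog (R : realType) (n : nat) :
  (0 < n)%N -> ln (n%:R : R) <= (dlog n)%:R.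
Proof.
move=> n0; apply: (@le_trans _ _ (ln ((2 ^ dlog n)%:R : R))).
  rewrite ler_ln ?posrE ?ltr0n ?expn_gt0 // ler_nat ltnW //.
  exact: trunc_log_ltn.
rewrite natrX lnXn ?ltr0n // -[leLHS]mulr_natl.
(* [ln 2 <= 1] is the case [x = 1] of [ln (1 + x) <= x]. *)
rewrite ler_piMr //; have := @le_ln1Dx R 1; rewrite -[1 + 1]/(2%:R); apply.
by rewrite (@lt_trans _ _ 0) // ltrN10.
Qed.

(** For [2 <= n] the extra 1 in [dlog n] is at most the base-2 logarithm of [n], hence the 2 in the
    constant. *)
Lemma dlog_le_ln (R : realType) (n : nat) :
  (2 <= n)%N -> ((dlog n)%:R : R) <= 2 / ln 2 * ln n%:R.
Proof.
move=> n2; rewrite mulrAC ler_pdivlMr ?ln2_gt0 // [2 * _]mulr_natl (mulr2n (ln _)).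
rewrite /dlog -natr1 mulrDl mul1r lerD ?ln_nat_ge_ln2 //.
rewrite mulr_natl -lnXn // -natrX ler_ln ?posrE ?ltr0n ?expn_gt0 ?(leq_trans _ n2) //.
by rewrite ler_nat trunc_logP // (leq_trans _ n2).
Qed.

Lemma powR_nat_le (R : realType) (r : R) :
  exists e : nat, forall x : R, 1 <= x -> x `^ r <= x ^+ e.
Proof.
exists (Num.trunc r).+1 => x x1; rewrite -powR_mulrn ?(le_trans ler01) //.
by apply: ler_powR => //; rewrite ltW // truncnS_gt.
Qed.

(** Trades a real exponent of either sign for a natural power of [dlog]. For [D >= 0] this follows
    from [ln n <= dlog n]; for [D < 0] the left side is at most its value at [n = 2]. *)
Lemma powR_ln_le_dlog (R : realType) (D : R) :
  exists K : R, 0 < K /\ exists E : nat, forall n : nat, (2 <= n)%N ->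
    powR (ln n%:R) D <= K * (dlog n)%:R ^+ E.
Proof.
have dlog1 n : 1 <= (dlog n)%:R :> R by rewrite ler1n.
have [D0|D0] := leP 0 D.
  have [E DE] := powR_nat_le R D; exists 1; split => //; exists E => n n2.
  rewrite mul1r; apply: le_trans (DE _ (dlog1 n)).
  have n0 : (0 < n)%N by apply: leq_trans n2.
  rewrite ge0_ler_powR ?nnegrE ?ler0n ?ln_le_dlog //.
  by rewrite ln_ge0 // ler1n.
exists (ln 2 `^ D); split; first by rewrite powR_gt0 ?ln2_gt0.
exists 0%N => n n2; rewrite expr0 mulr1 -[D]opprK !(powRN _ (- D)).
have ln0 : 0 < ln (n%:R : R) by rewrite (lt_le_trans (ln2_gt0 R)) ?ln_nat_ge_ln2.
rewrite lef_pV2 ?posrE ?powR_gt0 ?ln2_gt0 //.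
by rewrite ge0_ler_powR ?nnegrE ?ln_nat_ge_ln2 ?oppr_ge0 ?ltW ?ln2_gt0.
Qed.

Lemma powR_card_le1 (R : realType) (r : R) (n Q : nat) :
  0 < r -> (n <= 1)%N -> ((0 < n)%N -> (0 < Q)%N) -> n%:R `^ r <= Q%:R :> R.
Proof.
case: n => [|[|//]] r0 _ Q0; first by rewrite powR0 ?gt_eqF.
by rewrite powR1 ler1n Q0.
Qed.

Lemma dlog_bound_weaken (R : realType) (K K' : R) (E E' n Q : nat) :
    0 <= K -> K <= K' -> (E <= E')%N ->
  K * (dlog n)%:R ^+ E * Q%:R <= K' * (dlog n)%:R ^+ E' * Q%:R :> R.
Proof.
move=> K0 KK EE; rewrite ler_wpM2r // ler_pM ?exprn_ge0 //.
by rewrite ler_weXn2l // ler1n.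
Qed.

(** Form of the hypothesis valid for every [B], even empty or a singleton, as needed for the sets of
    values met in the induction. *)
Lemma sum_product_dlog (R : realType) (delta : R) :
    0 < delta -> sum_product_exponent delta ->
  exists K : R, 0 < K /\ exists E : nat, forall B : {fset R},
    powR #|` B|%:R (1 + delta) <=
      K * (dlog #|` B|)%:R ^+ E * (#|` rsumset B| + #|` rprodset B|)%:R.
Proof.
move=> d0 [C [C0 [D spD]]].
have [K [K0 [E lnE]]] := powR_ln_le_dlog R (- D).
(* The summand 1 serves sets with at most one element, [C^-1 * K] all others. *)
exists (1 + C^-1 * K); split; first by rewrite ltr_pwDl // mulr_ge0 ?invr_ge0 ?ltW.
exists E => B; set q := (#|` rsumset B| + #|` rprodset B|)%:R.
have [B2|B2] := leqP 2 #|` B|; last first.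
  apply: (@le_trans _ _ (1 * (dlog #|` B|)%:R ^+ 0 * q)).
    rewrite expr0 !mul1r powR_card_le1 ?addr_gt0 // => B0.
    by rewrite addn_gt0 (card_opset_gt0 _ (fun a b => a + b)).
  by apply: dlog_bound_weaken; rewrite // lerDl mulr_ge0 ?invr_ge0 ?ltW.
have l0 : 0 < ln (#|` B|%:R : R) by rewrite (lt_le_trans (ln2_gt0 R)) ?ln_nat_ge_ln2.
apply: (@le_trans _ _ (C^-1 * K * (dlog #|` B|)%:R ^+ E * q)); last first.
  by apply: dlog_bound_weaken; rewrite ?lerDr // mulr_ge0 ?invr_ge0 ?ltW.
rewrite -2!mulrA mulrC ler_pdivlMr // mulrA.
rewrite -(ler_pM2r (powR_gt0 D l0)); apply: (@le_trans _ _ q).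
  by rewrite [_ * C]mulrC; exact: spD.
rewrite mulrAC ler_peMl // -[D]opprK powRN ler_pdivlMr ?powR_gt0 // mul1r.
exact: lnE.
Qed.

(** * Diagonal matrices seen through their entries *)

Definition entry {R : realType} {d : nat} (i : 'I_d) (a : 'M[R]_d) : R := a i i.

Definition diag_fset {R : realType} {d : nat} (A : {fset 'M[R]_d}) : Prop :=
  {in A, forall a, is_diag_mx a}.

(** Covers both reasons for ignoring a coordinate outside [S]: it vanishes on a sign class, or it
    has been fixed by passing to a fibre. *)
Definition separates {R : realType} {d : nat} (S : {set 'I_d})
    (A : {fset 'M[R]_d}) : Prop :=
  {in A &, forall a b, {in S, forall i, entry i a = entry i b} -> a = b}.

(** Taking [a = b] shows that the entries indexed by [S] are also nonzero. *)
Definition same_sign {R : realType} {d : nat} (S : {set 'I_d})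
    (A : {fset 'M[R]_d}) : Prop :=
  {in A &, forall a b, {in S, forall i, 0 < entry i a * entry i b}}.

Definition growth {R : realType} {d : nat} (A : {fset 'M[R]_d}) : nat :=
  (#|` msumset A| + #|` mprodset A|)%N.

Lemma entryD (R : realType) (d : nat) (i : 'I_d) :
  {morph @entry R d i : a b / a + b}.
Proof. by move=> a b; rewrite /entry mxE. Qed.

Lemma entryM (R : realType) (d : nat) (A : {fset 'M[R]_d}) (i : 'I_d) :
  diag_fset A -> {in A &, {morph @entry R d i : a b / a *m b >-> a * b}}.
Proof.
move=> dA a b aA _; rewrite /entry mxE (bigD1 i) //= big1 ?addr0 // => j ji.
by have /is_diag_mxP-> := dA a aA; rewrite ?mul0r // eq_sym.
Qed.

Lemma entry_neq0 (R : realType) (d : nat) (A : {fset 'M[R]_d})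
    (S : {set 'I_d}) (i : 'I_d) :
  same_sign S A -> i \in S -> {in A, forall a, entry i a != 0}.
Proof.
move=> sgnA iS a aA; have := sgnA a a aA aA i iS.
by apply: contraTneq => ->; rewrite mul0r ltxx.
Qed.

Lemma growth_fibres (R : realType) (d : nat) (A : {fset 'M[R]_d})
    (S : {set 'I_d}) (i : 'I_d) (X : {fset R}) (m : nat) :
    diag_fset A -> separates S A -> same_sign S A ->
    (0 < m)%N -> {in X, forall x, (m <= #|` fibre (entry i) A x|)%N} ->
  ((#|` rsumset X| + #|` rprodset X|) * m <= growth A)%N.
Proof.
move=> dA sepA sgnA m0 Xm; rewrite mulnDl leq_add //.
  apply: (@card_opset_fibres _ _ +%R +%R (entry i)) => //.
    by move=> a b _ _; rewrite entryD.
  by move=> b a a' _ _ _; exact: addIr.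
apply: (@card_opset_fibres _ _ (@mulmx R d d d) *%R (entry i)) => //.
  exact: entryM.
(* The matrix [b] may be singular, but its entries in [S] can be cancelled, and [S] separates the
   points of [A]. *)
move=> b a a' bA aA a'A ab; apply: sepA => // j jS.
by apply: (mulIf (entry_neq0 _ _ _ _ _ sgnA jS b bA)); rewrite -!(entryM _ _ A) // ab.
Qed.

Lemma sum_growth_fibre (R : realType) (d : nat) (A : {fset 'M[R]_d})
    (S : {set 'I_d}) (i : 'I_d) (X : {fset R}) :
    diag_fset A -> same_sign S A -> i \in S ->
  (\sum_(x <- X) growth (fibre (entry i) A x) <= growth A)%N.
Proof.
move=> dA sgnA iS; rewrite big_split /= leq_add //.
  apply: (@sum_card_opset_fibre _ _ +%R +%R (entry i)).
    by move=> a b _ _; rewrite entryD.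
  by move=> a b _ _ /eqP; rewrite -!mulr2n eqrMn2r // => /eqP.
apply: (@sum_card_opset_fibre _ _ (@mulmx R d d d) *%R (entry i)).
  exact: entryM.
(* Equal squares leave the alternative of opposite entries, whose product is not positive, against
   [same_sign]. *)
move=> a b aA bA /eqP; rewrite -!expr2 eqf_sqr => /orP[/eqP//|/eqP ab].
have := sgnA a b aA bA i iS; rewrite ab mulNr oppr_gt0 ltNge.
by rewrite -expr2 sqr_ge0.
Qed.

Lemma diag_fset_fibre (R : realType) (d : nat) (A : {fset 'M[R]_d}) (i : 'I_d) (x : R) :
  diag_fset A -> diag_fset (fibre (entry i) A x).
Proof. by move=> dA a /fibreP[aA _]; exact: dA. Qed.

Lemma separates_fibre (R : realType) (d : nat) (A : {fset 'M[R]_d})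
    (S : {set 'I_d}) (i : 'I_d) (x : R) :
  separates S A -> separates (S :\ i) (fibre (entry i) A x).
Proof.
move=> sepA a b /fibreP[aA ax] /fibreP[bA bx] ab; apply: sepA => // j jS.
have [->|ji] := eqVneq j i; first by rewrite ax bx.
by apply: ab; rewrite !inE ji.
Qed.

Lemma same_sign_fibre (R : realType) (d : nat) (A : {fset 'M[R]_d})
    (S : {set 'I_d}) (i : 'I_d) (x : R) :
  same_sign S A -> same_sign (S :\ i) (fibre (entry i) A x).
Proof.
move=> sgnA a b /fibreP[aA _] /fibreP[bA _] j; rewrite !inE => /andP[_ jS].
exact: sgnA.
Qed.

Lemma separates_set0_card (R : realType) (d : nat) (A : {fset 'M[R]_d}) :
  separates set0 A -> (#|` A| <= 1)%N.
Proof.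
move=> sepA; apply: card_le1_inj => a b aA bA; apply: sepA => // i.
by rewrite inE.
Qed.

Lemma growth_gt0 (R : realType) (d : nat) (A : {fset 'M[R]_d}) :
  (0 < #|` A|)%N -> (0 < growth A)%N.
Proof. by move=> A0; rewrite addn_gt0 (card_opset_gt0 _ +%R). Qed.

(** * Exponent arithmetic for the two cases of the induction *)

(** The first bound controls the factor [n]; the second, raised to the power [delta / k.+1],
    controls the other factor by [(p * N) ^ delta]. *)
Lemma powR_many_fibres (R : realType) (delta : R) (p N m n k : nat) :
    0 < delta -> (n <= p * (N * m))%N -> (n <= (p * N) ^ k.+1)%N ->
  n%:R * n%:R `^ (delta / k.+1%:R) <=
    p%:R `^ (1 + delta) * (N%:R `^ (1 + delta) * m%:R) :> R.
Proof.
move=> d0 nM nk.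
have powR_1D (x : R) : 0 <= x -> x `^ (1 + delta) = x * x `^ delta.
  by move=> x0; rewrite powRD ?powRr1 // gt_eqF // addr_gt0.
rewrite !powR_1D ?ler0n // (mulrAC N%:R) mulrACA -powRM ?ler0n // -!natrM.
rewrite ler_pM ?powR_ge0 ?ler0n ?ler_nat //.
apply: (@le_trans _ _ ((((p * N) ^ k.+1)%:R : R) `^ (delta / k.+1%:R))).
  by rewrite ge0_ler_powR ?nnegrE ?ler0n ?ler_nat // divr_ge0 ?ler0n // ltW.
by rewrite natrX -powR_mulrn ?ler0n // -powRrM mulrC divfK ?pnatr_eq0.
Qed.

(** Divide [n ^ k.+1 <= M ^ k.+1 * m ^ k.+1 < n * m ^ k.+1] by [n]. *)
Lemma expn_few_fibres (M m n k : nat) :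
  (0 < m)%N -> (n <= M * m)%N -> (M ^ k.+1 < n)%N -> (n ^ k < m ^ k.+1)%N.
Proof.
move=> m0 nM Mn; rewrite -(@ltn_pmul2l n) ?(leq_trans _ Mn) // -expnS.
have: (n ^ k.+1 <= (M * m) ^ k.+1)%N by rewrite leq_exp2r.
move=> /leq_ltn_trans; apply.
by rewrite expnMn ltn_pmul2r // expn_gt0 m0.
Qed.

Lemma powR_few_fibres (R : realType) (delta : R) (m n k : nat) :
    0 < delta -> (0 < k)%N -> (n ^ k <= m ^ k.+1)%N ->
  n%:R `^ (delta / k.+1%:R) <= m%:R `^ (delta / k%:R) :> R.
Proof.
(* Raising the hypothesis to the power [r] gives the claim. *)
move=> d0 k0 nm; pose r := delta / (k%:R * k.+1%:R).
have k_neq0 j : (0 < j)%N -> (j%:R : R) != 0 by rewrite pnatr_eq0 -lt0n.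
have -> : delta / k.+1%:R = k%:R * r.
  by rewrite /r invfM mulrCA (mulrA k%:R) divff ?mul1r ?k_neq0.
have -> : delta / k%:R = k.+1%:R * r.
  by rewrite /r invfM mulrCA (mulrCA k.+1%:R) divff ?mulr1 ?k_neq0.
have r0 : 0 <= r by rewrite divr_ge0 ?mulr_ge0 ?ler0n // ltW.
clearbody r; rewrite !powRrM !powR_mulrn ?ler0n // -!natrX.
by rewrite ge0_ler_powR ?nnegrE ?ler0n ?ler_nat.
Qed.

(** * Induction on the number of relevant coordinates *)

Lemma signed_growth (R : realType) (delta : R) (d : nat) :
    0 < delta -> sum_product_exponent delta ->
  forall k : nat, exists K : R, 0 < K /\ exists E : nat,
    forall (A : {fset 'M[R]_d}) (S : {set 'I_d}),
      diag_fset A -> separates S A -> same_sign S A -> (#|S| <= k)%N ->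
    #|` A|%:R `^ (1 + delta / k%:R) <=
      K * (dlog #|` A|)%:R ^+ E * (growth A)%:R.
Proof.
move=> d0 spd.
have [K0 [K0_gt0 [E0 spE]]] := sum_product_dlog R delta d0 spd.
have [e powR_e] := powR_nat_le R (1 + delta).
have exp_gt0 k : 0 < 1 + delta / k%:R.
  by rewrite ltr_pwDl // divr_ge0 ?ler0n // ltW.
have small k (A : {fset 'M[R]_d}) (K : R) (E : nat) : (#|` A| <= 1)%N -> 1 <= K ->
    #|` A|%:R `^ (1 + delta / k%:R) <= K * (dlog #|` A|)%:R ^+ E * (growth A)%:R.
  move=> A1 K1; apply: (@le_trans _ _ (1 * (dlog #|` A|)%:R ^+ 0 * (growth A)%:R)).
    rewrite expr0 !mul1r powR_card_le1 //; exact: growth_gt0.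
  exact: dlog_bound_weaken.
(* At [k = 0] the quotient [delta / 0] is 0 by convention, which is harmless: there [A] has at most
   one element. *)
elim=> [|k [K [K_gt0 [E IH]]]].
  exists 1; split => //; exists 0%N => A S _ sepA _.
  rewrite leqn0 cards_eq0 => /eqP S0; rewrite S0 in sepA.
  by apply: small => //; exact: separates_set0_card.
(* The three summands serve the trivial case, many values and few values; the exponent chosen below
   dominates [e + E0] and [E.+1] alike. *)
pose K' := 1 + 2 ^+ e * K0 + 2 * K.
have p1 : 0 <= 2 ^+ e * K0 by rewrite mulr_ge0 ?exprn_ge0 ?ltW.
have p2 : 0 <= 2 * K by rewrite mulr_ge0 ?ltW.
exists K'; split; first by rewrite /K' -addrA ltr_pwDl // addr_ge0.
exists (e + E0 + E.+1)%N => A S dA sepA sgnA Sk.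
have K'1 : 1 <= K' by rewrite /K' -addrA lerDl addr_ge0.
have [A1|A_gt1] := leqP #|` A| 1; first exact: small.
have [S0|/set0Pn[i iS]] := eqVneq S set0.
  by rewrite S0 in sepA; apply: small => //; exact: separates_set0_card.
have Sik : (#|S :\ i| <= k)%N.
  by rewrite -ltnS (leq_trans _ Sk) // [leqRHS](cardsD1 i) iS.
have [X [m [m0 XA Xm Am]]] := dyadic_fibres _ _ (entry i) A.
set n := #|` A| in A_gt1 Am XA *; set l := dlog n in Am *.
have n0 : (n%:R : R) != 0 by rewrite pnatr_eq0 -lt0n (leq_trans _ A_gt1).
rewrite powRD ?n0 ?implybT // powRr1 ?ler0n //.
have [wide|narrow] := leqP n (((2 * l) * #|` X|) ^ k.+1)%N.
  apply: le_trans (powR_many_fibres R delta _ _ _ _ _ d0 Am wide) _.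
  apply: (@le_trans _ _ (2 ^+ e * K0 * l%:R ^+ (e + E0) * (growth A)%:R)); last first.
    by apply: dlog_bound_weaken; rewrite ?leq_addr //
      /K' addrAC lerDr addr_ge0 // ler01.
  rewrite exprD mulrACA -exprMn -mulrA -natrM.
  have q1 : 1 <= (2 * l)%:R :> R by rewrite ler1n muln_gt0.
  apply: ler_pM (powR_e _ q1) _; rewrite ?powR_ge0 ?mulr_ge0 ?powR_ge0 ?ler0n //.
  apply: (@le_trans _ _ (K0 * l%:R ^+ E0 *
    (#|` rsumset X| + #|` rprodset X|)%:R * m%:R)).
    rewrite ler_wpM2r ?ler0n //; apply: le_trans (spE X) _.
    rewrite ler_wpM2r ?ler0n // ler_wpM2l ?(ltW K0_gt0) // lerXn2r ?nnegrE ?ler0n //.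
    by rewrite ler_nat leq_dlog.
  rewrite -mulrA -natrM ler_wpM2l ?mulr_ge0 ?exprn_ge0 ?(ltW K0_gt0) //.
  by rewrite ler_nat (growth_fibres _ _ _ S i).
have fibre_IH x := IH _ _ (diag_fset_fibre _ _ _ i x dA)
  (separates_fibre _ _ _ _ i x sepA) (same_sign_fibre _ _ _ _ i x sgnA) Sik.
have nkm : (n ^ k < m ^ k.+1)%N by apply: expn_few_fibres narrow => //; rewrite -mulnA.
(* If [k = 0], removing [i] leaves no coordinate, so fibres have at most one point and [m <= 1],
   whereas [nkm] reads [1 < m]. *)
have k0 : (0 < k)%N.
  case: (posnP k) => // k0; exfalso; move: nkm; rewrite k0 expn0 expn1 ltnNge.
  have /fset0Pn[x xX] : X != fset0.
    apply: contraTneq A_gt1 => X0; move: Am; rewrite X0 cardfs0 mul0n muln0.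
    by rewrite leqn0 => /eqP->.
  apply/negP/negPn; apply: leq_trans (Xm x xX) _.
  apply: separates_set0_card.
  move: Sik; rewrite k0 leqn0 cards_eq0 => /eqP <-; exact: separates_fibre.
apply: (@le_trans _ _ (2 * K * l%:R ^+ E.+1 * (growth A)%:R)); last first.
  by apply: dlog_bound_weaken; rewrite ?leq_addl // /K' lerDr addr_ge0.
apply: (@le_trans _ _ (((2 * l) * (#|` X| * m))%:R * m%:R `^ (delta / k%:R))).
  rewrite ler_pM ?powR_ge0 ?ler0n ?ler_nat //.
  exact: powR_few_fibres (ltnW nkm).
(* Spread the bound over [X], one term [m ^ (1 + delta / k)] per fibre, so that the induction
   hypothesis applies to each term. *)
have -> : ((2 * l) * (#|` X| * m))%:R * m%:R `^ (delta / k%:R) =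
    (2 * l%:R) * \sum_(x <- X) m%:R `^ (1 + delta / k%:R) :> R.
  rewrite big_const_seq count_predT iter_addr_0 -[_ *+ #|` X|]mulr_natl.
  rewrite powRD ?powRr1 ?ler0n ?pnatr_eq0 ?(gtn_eqF m0) ?implybT //.
  by rewrite !natrM !mulrA.
rewrite exprS mulrACA -!mulrA !ler_wpM2l ?ler0n //.
apply: (@le_trans _ _ (\sum_(x <- X)
  K * l%:R ^+ E * (growth (fibre (entry i) A x))%:R)).
  rewrite big_seq [leRHS]big_seq; apply: ler_sum => x xX.
  apply: (@le_trans _ _ (#|` fibre (entry i) A x|%:R `^ (1 + delta / k%:R))).
    by rewrite ge0_ler_powR ?nnegrE ?ler0n ?ler_nat ?(ltW (exp_gt0 _)) ?Xm.
  apply: le_trans (fibre_IH x) _.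
  rewrite ler_wpM2r ?ler0n // ler_wpM2l ?(ltW K_gt0) // lerXn2r ?nnegrE ?ler0n //.
  by rewrite ler_nat leq_dlog // fsubset_leq_card ?fibre_sub.
rewrite -big_distrr -natr_sum mulrA /= ler_wpM2l ?mulr_ge0 ?exprn_ge0 ?(ltW K_gt0) //.
by rewrite ler_nat (sum_growth_fibre _ _ _ S).
Qed.

(** * Sign classes and the conclusion for all diagonal sets *)

Definition sign_pattern {R : realType} {d : nat} (a : 'M[R]_d) :
  {ffun 'I_d -> bool * bool} := [ffun i => (0 < entry i a, entry i a < 0)].

(** Outside [S] neither strict sign holds, so the diagonal entry is zero throughout the class;
    off-diagonal entries vanish as well, so only [S] can distinguish two matrices. *)
Lemma sign_pattern_fibre (R : realType) (d : nat) (A : {fset 'M[R]_d})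
    (p : {ffun 'I_d -> bool * bool}) (S := [set i | (p i).1 || (p i).2]) :
    diag_fset A ->
  separates S (fibre sign_pattern A p) /\ same_sign S (fibre sign_pattern A p).
Proof.
move=> dA; have pE a i : a \in fibre sign_pattern A p ->
    p i = (0 < entry i a, entry i a < 0).
  by move=> /fibreP[_ <-]; rewrite ffunE.
split=> a b ap bp.
  move=> ab; have /fibreP[aA _] := ap; have /fibreP[bA _] := bp.
  apply/matrixP => i j; have [<-|ij] := eqVneq i j; last first.
      have diag0 := fun c cA => is_diag_mxP (dA c cA) i j ij.
    by rewrite !diag0.
  have [/ab//|] := boolP (i \in S).
  rewrite inE {1}(pE a) // (pE b) // negb_or /= -!leNgt => /andP[a0 b0].
  have := pE a i ap; rewrite (pE b i bp) => -[ab1 ab2].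
  rewrite -[a i i]/(entry i a) -[b i i]/(entry i b).
  have /eqP-> : entry i a == 0 by rewrite eq_le a0 /= leNgt -ab2 -leNgt.
  by apply/esym/eqP; rewrite eq_le b0 andbT leNgt ab1 -leNgt.
move=> i; rewrite inE (pE a) //=.
have := pE a i ap; rewrite (pE b i bp) => -[ab1 ab2].
move=> /orP[a0|a0]; first by rewrite mulr_gt0 // ab1.
by rewrite nmulr_rgt0 // ab2.
Qed.

Lemma growth_sub (R : realType) (d : nat) (A B : {fset 'M[R]_d}) :
  A `<=` B -> (growth A <= growth B)%N.
Proof.
move=> AB; apply: leq_add; apply: fsubset_leq_card.
  exact: (@opset_sub _ +%R).
exact: (@opset_sub _ (@mulmx R d d d)).
Qed.

Theorem theorem1p2 (R : realType) (delta1 : R) (d : nat) :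
  0 < delta1 -> sum_product_exponent delta1 -> (0 < d)%N ->
  exists C : R, 0 < C /\ exists D : R,
    forall A : {fset 'M[R]_d}, diag_set A -> (2 <= #|` A|)%N ->
      C * powR (#|` A|%:R) (1 + delta1 / d%:R) * powR (ln (#|` A|%:R)) D
        <= (#|` msumset A| + #|` mprodset A|)%:R.
Proof.
move=> d0 spd _; set r := 1 + _.
have r_ge0 : 0 <= r by rewrite addr_ge0 // divr_ge0 ?ler0n // ltW.
have [K [K0 [E KE]]] := signed_growth R delta1 d d0 spd d.
pose P : finType := {ffun 'I_d -> bool * bool}.
have P0 : (0 < #|P|)%N by apply/card_gt0P; exists [ffun=> (true, true)].
(* The factor [#|P| ^ r] pays for passing to the largest sign class, [K] comes from [signed_growth],
   and [(2 / ln 2) ^+ E] from turning [dlog] back into [ln]. Moving [c] and the [E]-th power of the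
   logarithm to the other side gives [C = c^-1] and [D = - E]. *)
pose c := #|P|%:R `^ r * (K * (2 / ln 2) ^+ E) : R.
have c0 : 0 < c.
  by rewrite !mulr_gt0 ?powR_gt0 ?ltr0n ?exprn_gt0 ?divr_gt0 ?ln2_gt0.
exists c^-1; split; first by rewrite invr_gt0.
exists (- E%:R) => A /forallP diagA A2.
have dA : diag_fset A by move=> a aA; exact: diagA [` aA].
have [p Ap] := exists_large_fibre _ P sign_pattern A P0.
set B := fibre sign_pattern A p in Ap.
have BA : B `<=` A by exact: fibre_sub.
have dB : diag_fset B by move=> a /(fsubsetP BA); exact: dA.
have [sepB sgnB] := sign_pattern_fibre R d A p dA.
have := KE _ _ dB sepB sgnB; rewrite -/r => /(_ _)KB.
have ln0 : 0 < ln (#|` A|%:R : R).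
  by rewrite (lt_le_trans (ln2_gt0 R)) ?ln_nat_ge_ln2.
rewrite powR_invn ?(ltW ln0) // -mulrA ler_pdivrMl // ler_pdivrMr ?exprn_gt0 //.
apply: (@le_trans _ _ (#|P|%:R `^ r * #|` B|%:R `^ r)).
  rewrite -powRM ?ler0n // -natrM.
  by rewrite ge0_ler_powR ?nnegrE ?ler0n ?ler_nat.
rewrite /c -!mulrA ler_wpM2l ?powR_ge0 //.
apply: le_trans (KB _) _; first by rewrite (leq_trans (max_card _)) ?card_ord.
rewrite -mulrA ler_wpM2l ?(ltW K0) // [leRHS]mulrCA -exprMn [leRHS]mulrC.
rewrite ler_pM ?exprn_ge0 ?ler0n ?ler_nat ?growth_sub //.
rewrite lerXn2r ?nnegrE ?ler0n ?mulr_ge0 ?ler0n ?invr_ge0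
  ?(ltW (ln2_gt0 R)) ?(ltW ln0) //.
apply: le_trans (dlog_le_ln R _ A2).
by rewrite ler_nat leq_dlog ?fsubset_leq_card.
Qed.
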